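(* Let $f\in\mathbb{R}[x]$, $x=(x_1,\dots,x_n)$, be a polynomial which is positive on a compact and convex set $X\subset\mathbb{R}^n$. Let $R=\max\{|x|:x\in X\}$ and let $m$ be a real number with $0<m\le\min\{f(x):x\in X\}$. Then for any $\xi\in\mathbb{R}^n$, any $D\ge D_n(f,R)$ and any real $N>\mathcal{N}(m,D)$, the function $\varphi_{N,\xi}(x):=e^{N|x-\xi|^2}f(x)$ is strongly convex on $X$.
   Context: $|\cdot|$ is the Euclidean norm on $\mathbb{R}^n$. For positive numbers $m,D$, $\mathcal{N}(m,D):=\frac{D}{2m}+\frac{D^2}{2m^2}$. For a polynomial $f=\sum_{j=0}^d\sum_{|\nu|=j}a_\nu x^\nu$ with $a_\nu\in\mathbb{R}$ (where $\nu\in\mathbb{N}^n$, $0\in\mathbb{N}$, $|\nu|=\nu_1+\cdots+\nu_n$, $x^\nu=x_1^{\nu_1}\cdots x_n^{\nu_n}$) and $R>0$, $$D_n(f,R):=\max\Big\{1,\ \sum_{j=1}^d\sum_{|\nu|=j}j|a_\nu|R^{j-1},\ \sum_{j=1}^d\sum_{|\nu|=j}j(j-1)|a_\nu|R^{j-2}\Big\}.$$ A function $\varphi$ is strongly convex on a convex set $X$ if for some $\mu>0$ the function $\varphi(x)-\frac{\mu}{2}|x|^2$ is convex on $X$. *)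

(* Defs.v *)
From HB Require Import structures.
From mathcomp Require Import all_boot all_order all_algebra.
From mathcomp Require Import all_classical all_reals all_analysis.
(* The notations of [mpoly] are incompatible with those of MathComp-Analysis. *)
From mathcomp Require Import -(notations) mpoly.

Set Implicit Arguments.
Unset Strict Implicit.
Unset Printing Implicit Defensive.

Import Order.TTheory GRing.Theory Num.Theory.
Import numFieldNormedType.Exports.

Local Open Scope classical_set_scope.
Local Open Scope ring_scope.

(* The Euclidean norm; the library norm [`|x|] on ['rV[R]_n] is the sup norm. *)
Definition enorm (R : realType) (n : nat) (x : 'rV[R]_n) : R :=
  Num.sqrt (\sum_(i < n) x ord0 i ^+ 2).

Definition is_max (R : realType) (A : set R) (M : R) : Prop :=
  A M /\ ubound A M.

Definition is_min (R : realType) (A : set R) (M : R) : Prop :=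
  A M /\ lbound A M.

Definition peval (R : realType) (n : nat) (f : mpoly n R) (x : 'rV[R]_n) : R :=
  meval (fun i => x ord0 i) f.

Definition calN (R : realType) (m D : R) : R :=
  D / (2 * m) + D ^+ 2 / (2 * m ^+ 2).

(* [mmeasure mdeg f] is 1 + deg f (and 0 for f = 0), so j ranges over 1..deg f
   and nu over all multi-indices of degree j.  For j = 1 the exponent [j - 2] is
   truncated to 0, but the coefficient j (j - 1) of that term vanishes. *)
Definition Dn (R : realType) (n : nat) (f : mpoly n R) (r : R) : R :=
  let s := mmeasure mdeg f in
  Num.max 1 (Num.max
    (\sum_(1 <= j < s) \sum_(nu : bmultinom n s | mdeg nu == j)
        j%:R * `|mcoeff nu f| * r ^+ (j - 1))
    (\sum_(1 <= j < s) \sum_(nu : bmultinom n s | mdeg nu == j)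
        j%:R * (j%:R - 1) * `|mcoeff nu f| * r ^+ (j - 2))).

Definition strongly_convex (R : realType) (n : nat) (X : set 'rV[R]_n)
    (phi : 'rV[R]_n -> R) : Prop :=
  exists2 mu : R, 0 < mu &
    @convex_function R 'rV[R]_n X (fun x => phi x - mu / 2 * enorm x ^+ 2).

(* Main.v *)
Require Import Defs.
From HB Require Import structures.
From mathcomp Require Import all_boot all_order all_algebra.
From mathcomp Require Import all_classical all_reals all_analysis.
From mathcomp Require Import -(notations) mpoly.
From mathcomp Require Import ring lra.

Import Order.TTheory GRing.Theory Num.Theory.
Import numFieldNormedType.Exports.

Local Open Scope classical_set_scope.
Local Open Scope ring_scope.

(** Convexity is a statement about segments.  On the segment t |-> y + t w both
    f and |x - xi|^2 become univariate polynomials p(t) and s(t), and with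
    Q = N s the function e^Q p has second derivative
      e^Q ((Q'^2 + Q'') p + 2 Q' p' + p''),   where Q'' = 2 N |w|^2.
    Completing the square in Q' gives Q'^2 p + 2 Q' p' >= - p'^2 / p, so the
    factor of e^Q is at least 2 N |w|^2 p + p'' - p'^2 / p.

    Differentiating a monomial of degree j along w, where |x| <= r, produces j
    (resp. j (j - 1)) products with one (resp. two) factors w_i, each at most
    |w|, and the remaining factors at most r.  Summing over monomials,
    |p'| <= |w| D_n(f, r) <= |w| D and |p''| <= |w|^2 D
    ([line_poly_deriv_le]).  As p >= m on X, the factor of e^Q is then at least
    mu |w|^2 with mu = 2 N m - D - D^2 / m ([quadratic_ge]), and mu > 0 says
    exactly that N > D / (2 m) + D^2 / (2 m^2) ([calN_gap]).  Finally e^Q >= 1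
    because N >= 0, so mu |w|^2, which is the second derivative of
    (mu / 2) |y + t w|^2, can be subtracted: e^Q p - (mu / 2) |y + t w|^2 is
    convex on the segment ([expR_horner_chord]), and the same mu serves for all
    segments. *)

(** * The Euclidean norm and segments *)

Lemma enorm_ge0 (R : realType) (n : nat) (x : 'rV[R]_n) : 0 <= enorm x.
Proof. exact: sqrtr_ge0. Qed.

Lemma enorm_sqr (R : realType) (n : nat) (x : 'rV[R]_n) :
  enorm x ^+ 2 = \sum_(i < n) x ord0 i ^+ 2.
Proof. by rewrite sqr_sqrtr// sumr_ge0// => i _; rewrite sqr_ge0. Qed.

Lemma coord_le_enorm (R : realType) (n : nat) (x : 'rV[R]_n) (i : 'I_n) :
  `|x ord0 i| <= enorm x.
Proof.
rewrite -sqrtr_sqr ler_wsqrtr// (bigD1 i)//= lerDl.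
by rewrite sumr_ge0// => j _; rewrite sqr_ge0.
Qed.

(** Keeps [conv] in the affine form x + t w in which the polynomial
    restrictions below are phrased. *)
Lemma convE_line (R : realType) (V : lmodType R) (t : {i01 R})
    (a b : convex_lmodType V) :
  conv t a b = (b : V) + t%:num *: ((a : V) - b).
Proof.
transitivity (t%:num *: (a : V) + (1 - t%:num) *: (b : V)) => //.
by rewrite scalerBl scale1r scalerBr addrCA.
Qed.

(** * Convexity of exponential-polynomial functions of one variable *)

(** The derivative has the same shape as the function, with p replaced by
    Q' p + p', so that this lemma also yields the second derivative. *)
Lemma is_derive_expR_horner (R : realType) (Q p q : {poly R}) (t : R) :
  is_derive t (1 : R) (fun s => expR Q.[s] * p.[s] - q.[s])
    (expR Q.[t] * (Q^`() * p + p^`()).[t] - q^`().[t]).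
Proof.
have dQ : is_derive t (1 : R) (fun s => expR Q.[s]) (Q^`().[t] * expR Q.[t]).
  rewrite mulrC; apply: (@is_derive1_comp R expR (horner Q) t).
apply: is_derive_eq.
by rewrite !hornerE /GRing.scale /=; ring.
Qed.

(** The hypothesis is the nonnegativity of the second derivative of g on the
    open unit interval. *)
Lemma expR_horner_chord (R : realType) (Q p q : {poly R}) (t : {i01 R})
    (g := fun s => expR Q.[s] * p.[s] - q.[s]) :
  (forall s, 0 < s < 1 ->
    q^`()^`().[s] <= expR Q.[s] * ((Q^`().[s] ^+ 2 + Q^`()^`().[s]) * p.[s]
                                + 2 * Q^`().[s] * p^`().[s] + p^`()^`().[s])) ->
  g (1 - t%:inum) <= t%:inum * g 0 + (1 - t%:inum) * g 1.
Proof.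
move=> convg.
have D1g : 'D_1 g = fun s => expR Q.[s] * (Q^`() * p + p^`()).[s] - q^`().[s].
  apply/funext => s.
  exact: (@derive_val _ _ _ _ _ _ _ (is_derive_expR_horner R Q p q s)).
have cg s : {for s, continuous g}.
  apply/differentiable_continuous/derivable1_diffP.
  exact: (@ex_derive _ _ _ _ _ _ _ (is_derive_expR_horner R Q p q s)).
have := @second_derivative_convex R g 0 1 _ _ _ _ _ t ler01.
rewrite {1}/conv /= /conv /= !scaler0 add0r /GRing.scale /= mulr1; apply.
- move=> s s01; rewrite D1g.
  rewrite (@derive_val _ _ _ _ _ _ _ (is_derive_expR_horner R Q _ q^`() s)).
  have := convg s s01; rewrite -subr_ge0.
  congr (0 <= _ ); rewrite derivD derivM !hornerE /=.
  ring.
- exact/cvg_at_left_filter/cg.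
- exact/cvg_at_right_filter/cg.
- move=> s _.
  exact: (@ex_derive _ _ _ _ _ _ _ (is_derive_expR_horner R Q p q s)).
- move=> s _; rewrite D1g.
  exact: (@ex_derive _ _ _ _ _ _ _ (is_derive_expR_horner R Q _ q^`() s)).
Qed.

(** * Restriction of polynomials to a line *)

(** The restrictions to t |-> x + t w are taken as formal polynomials in t:
    their derivatives are then computed algebraically. *)
Definition line_coord {R : realType} {n : nat} (x w : 'rV[R]_n)
    (i : 'I_n) : {poly R} :=
  (x ord0 i)%:P + w ord0 i *: 'X.

Definition line_sqr {R : realType} {n : nat} (x w : 'rV[R]_n) : {poly R} :=
  \sum_(i < n) line_coord x w i ^+ 2.

Definition line_poly {R : realType} {n : nat} (f : mpoly n R)
    (x w : 'rV[R]_n) : {poly R} :=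
  mmap polyC (line_coord x w) f.

Lemma horner_line_coord (R : realType) (n : nat) (x w : 'rV[R]_n)
    (i : 'I_n) (t : R) :
  (line_coord x w i).[t] = (x + t *: w) ord0 i.
Proof. by rewrite !hornerE !mxE mulrC. Qed.

Lemma deriv_line_coord (R : realType) (n : nat) (x w : 'rV[R]_n) (i : 'I_n) :
  (line_coord x w i)^`() = (w ord0 i)%:P.
Proof. by rewrite derivD derivC derivZ derivX add0r -mul_polyC mulr1. Qed.

Lemma horner_line_sqr (R : realType) (n : nat) (x w : 'rV[R]_n) (t : R) :
  (line_sqr x w).[t] = enorm (x + t *: w) ^+ 2.
Proof.
rewrite enorm_sqr horner_sum; apply: eq_bigr => i _.
by rewrite horner_exp horner_line_coord.
Qed.

Lemma deriv2_line_sqr (R : realType) (n : nat) (x w : 'rV[R]_n) :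
  (line_sqr x w)^`()^`() = (2 * enorm w ^+ 2)%:P.
Proof.
rewrite !raddf_sum enorm_sqr mulr_sumr rmorph_sum /=.
apply: eq_bigr => i _.
rewrite expr2 derivM !deriv_line_coord derivD !derivM !deriv_line_coord !derivC.
by rewrite mul0r mulr0 add0r addr0 -!polyCM -!polyCD; congr polyC; ring.
Qed.

Lemma horner_line_poly (R : realType) (n : nat) (f : mpoly n R)
    (x w : 'rV[R]_n) (t : R) :
  (line_poly f x w).[t] = peval f (x + t *: w).
Proof.
rewrite /peval mevalE /line_poly /mmap horner_sum; apply: eq_bigr => nu _.
rewrite hornerM hornerC horner_prod; congr (_ * _); apply: eq_bigr => i _.
by rewrite horner_exp horner_line_coord.
Qed.

(** * Bounds on directional derivatives *)

(** The estimates at t satisfied by a product of k affine functions whose values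
    at t are at most r and whose slopes are at most B.  Where the natural
    subtractions k - 1 and k - 2 truncate, the coefficient in front vanishes. *)
Definition derivs_bounded {R : realType} (t r B : R) (k : nat)
    (p : {poly R}) : Prop :=
  [/\ `|p.[t]| <= r ^+ k,
      `|p^`().[t]| <= B * (k%:R * r ^+ (k - 1)) &
      `|p^`()^`().[t]| <= B ^+ 2 * (k%:R * (k%:R - 1) * r ^+ (k - 2))].

Lemma derivs_bounded1 (R : realType) (t r B : R) : derivs_bounded t r B 0 1.
Proof.
rewrite -[1 : {poly R}]/(1%:P).
by split; rewrite ?derivC hornerC ?normr1 ?normr0// mulr0n !mul0r mulr0.
Qed.

(** Leibniz: the second-order coefficients add up because
    j (j - 1) + 2 j k + k (k - 1) = (j + k) (j + k - 1). *)
Lemma derivs_boundedM (R : realType) (t r B : R) (j k : nat) (p q : {poly R}) :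
    0 <= r -> 0 <= B ->
  derivs_bounded t r B j p -> derivs_bounded t r B k q ->
  derivs_bounded t r B (j + k) (p * q).
Proof.
move=> r0 B0 [p0 p1 p2] [q0 q1 q2].
(* Truncated exponents add as expected as soon as the coefficient in front
   vanishes whenever truncation occurs. *)
have e1 (a b : nat) : a%:R * r ^+ (a - 1) * r ^+ b = a%:R * r ^+ (a + b - 1).
  case: a => [|a]; first by rewrite !mul0r.
  by rewrite -mulrA -exprD addSn !subn1.
have e2 (a b : nat) : a%:R * (a%:R - 1) * r ^+ (a - 2) * r ^+ b =
                      a%:R * (a%:R - 1) * r ^+ (a + b - 2).
  case: a => [|[|a]]; first by rewrite !mul0r.
    by rewrite subrr mulr0 !mul0r.
  by rewrite -mulrA -exprD !addSn !subn2.
have e11 : j%:R * r ^+ (j - 1) * (k%:R * r ^+ (k - 1)) =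
           j%:R * k%:R * r ^+ (j + k - 2).
  case: (j) => [|a]; first by rewrite !mul0r.
  case: (k) => [|b]; first by rewrite mul0r !mulr0 mul0r.
  rewrite !subn1 /= addSn addnS subn2 /= exprD; ring.
have rn (a : nat) : 0 <= r ^+ a by rewrite exprn_ge0.
have le_mul (a b c d : R) : `|a| <= c -> `|b| <= d -> `|a * b| <= c * d.
  by move=> ac bd; rewrite normrM ler_pM.
split.
- by rewrite hornerM exprD le_mul.
- rewrite derivM hornerD !hornerM (le_trans (ler_normD _ _))//.
  apply: le_trans (lerD (le_mul _ _ _ _ p1 q0) (le_mul _ _ _ _ p0 q1)) _.
  have := e1 j k; have := e1 k j; rewrite natrD [(k + j)%N]addnC => ekj ejk.
  rewrite mulrDl -ejk -ekj le_eqVlt; apply/orP; left; apply/eqP; ring.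
- have -> : (p * q)^`()^`().[t] =
      p^`()^`().[t] * q.[t] + (p^`().[t] * q^`().[t]) *+ 2
      + p.[t] * q^`()^`().[t].
    by rewrite derivM derivD !derivM !hornerE /=; ring.
  rewrite (le_trans (ler_normD _ _))//.
  apply: le_trans (lerD (ler_normD _ _) (lexx _)) _; rewrite normrMn.
  have := le_mul _ _ _ _ p2 q0; have := le_mul _ _ _ _ p1 q1.
  have := le_mul _ _ _ _ p0 q2 => h02 h11 h20.
  have h : B ^+ 2 * (j%:R * (j%:R - 1) * r ^+ (j - 2)) * r ^+ k
     + (B * (j%:R * r ^+ (j - 1)) * (B * (k%:R * r ^+ (k - 1)))) *+ 2
     + r ^+ j * (B ^+ 2 * (k%:R * (k%:R - 1) * r ^+ (k - 2)))
     = B ^+ 2 * ((j + k)%:R * ((j + k)%:R - 1) * r ^+ (j + k - 2)).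
    have := e2 j k; have := e2 k j; rewrite [(k + j)%N]addnC => ekj ejk.
    rewrite (_ : _ + _ + _ = B ^+ 2 * (j%:R * (j%:R - 1) * r ^+ (j - 2) * r ^+ k
       + (j%:R * r ^+ (j - 1) * (k%:R * r ^+ (k - 1))) *+ 2
       + k%:R * (k%:R - 1) * r ^+ (k - 2) * r ^+ j)); last by ring.
    by rewrite ejk ekj e11 natrD; ring.
  by rewrite -h lerD// lerD// lerMn2r.
Qed.

(** A monomial of degree k restricts to a product of k coordinate functions,
    each bounded by the Euclidean norm. *)
Lemma derivs_bounded_mmap1 (R : realType) (n : nat) (x w : 'rV[R]_n) (t r : R)
    (nu : multinom n) : enorm (x + t *: w) <= r ->
  derivs_bounded t r (enorm w) (mdeg nu) (mmap1 (line_coord x w) nu).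
Proof.
move=> xtw_r; have r0 : 0 <= r by apply: le_trans xtw_r; exact: enorm_ge0.
rewrite mdegE /mmap1; apply: big_ind2.
- exact: derivs_bounded1.
- by move=> *; apply: derivs_boundedM => //; exact: enorm_ge0.
move=> i _; elim: (nu i) => [|e IHe]; first exact: derivs_bounded1.
rewrite exprS -add1n; apply: derivs_boundedM => //; [exact: enorm_ge0|split].
- by rewrite horner_line_coord (le_trans (coord_le_enorm _ _ _ _)).
- by rewrite deriv_line_coord hornerC subnn expr0 !mulr1 coord_le_enorm.
- by rewrite deriv_line_coord derivC hornerC normr0 subrr mulr0 mul0r mulr0.
Qed.

(** Regroups the double sum over degrees and multi-indices of [Dn] as a single
    sum over multi-indices; the missing degree 0 has to contribute 0. *)
Lemma sum_by_mdeg (R : realType) (n s : nat) (F : nat -> bmultinom n s -> R) :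
    (forall nu, F 0 nu = 0) ->
  \sum_(1 <= j < s) \sum_(nu : bmultinom n s | mdeg nu == j) F j nu
  = \sum_(nu : bmultinom n s) F (mdeg nu) nu.
Proof.
move=> F0; case: s F F0 => [|s] F F0.
  by rewrite big_geq// big1// => -[nu nu_lt0]; have := nu_lt0; rewrite ltn0.
transitivity (\sum_(0 <= j < s.+1)
    \sum_(nu : bmultinom n s.+1 | mdeg nu == j) F j nu).
  by rewrite [RHS]big_ltn// [X in _ = X + _]big1 ?add0r// => nu _; exact: F0.
rewrite big_mkord (exchange_big_dep predT) //=; apply: eq_bigr => nu _.
by rewrite (big_pred1 (Ordinal (bmdeg nu))) // => j; rewrite eq_sym.
Qed.

Lemma Dn_ge (R : realType) (n : nat) (f : mpoly n R) (r : R) :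
  \sum_(nu : bmultinom n (mmeasure mdeg f))
     (mdeg nu)%:R * `|mcoeff nu f| * r ^+ (mdeg nu - 1) <= Dn f r /\
  \sum_(nu : bmultinom n (mmeasure mdeg f))
     (mdeg nu)%:R * ((mdeg nu)%:R - 1) * `|mcoeff nu f| * r ^+ (mdeg nu - 2)
    <= Dn f r.
Proof.
split.
- rewrite -(sum_by_mdeg _ _ _
    (fun j nu => j%:R * `|mcoeff nu f| * r ^+ (j - 1))).
    by rewrite /Dn !le_max lexx orbT.
  by move=> nu; rewrite !mul0r.
- rewrite -(sum_by_mdeg _ _ _
    (fun j nu => j%:R * (j%:R - 1) * `|mcoeff nu f| * r ^+ (j - 2))).
    by rewrite /Dn !le_max lexx !orbT.
  by move=> nu; rewrite !mul0r.
Qed.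

(** The two sums in [Dn] are the termwise bounds for the derivatives of the
    monomials, weighted by the absolute values of the coefficients. *)
Lemma line_poly_deriv_le (R : realType) (n : nat) (f : mpoly n R)
    (x w : 'rV[R]_n) (t r : R) : enorm (x + t *: w) <= r ->
  `|(line_poly f x w)^`().[t]| <= enorm w * Dn f r /\
  `|(line_poly f x w)^`()^`().[t]| <= enorm w ^+ 2 * Dn f r.
Proof.
move=> xtw_r.
have bnd (nu : bmultinom n (mmeasure mdeg f)) :=
  derivs_bounded_mmap1 _ _ x w t r nu xtw_r.
have lineE : line_poly f x w = \sum_(nu : bmultinom n (mmeasure mdeg f))
    (mcoeff nu f)%:P * mmap1 (line_coord x w) nu by exact: mmapE.
split.
- apply: le_trans (ler_wpM2l (enorm_ge0 _ _ w) (Dn_ge _ _ f r).1).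
  rewrite lineE raddf_sum horner_sum mulr_sumr.
  apply: le_trans (ler_norm_sum _ _ _) _; apply: ler_sum => nu _.
  rewrite /= mul_polyC derivZ hornerZ normrM.
  have [_ /(ler_wpM2l (normr_ge0 (mcoeff nu f))) h _] := bnd nu.
  by apply: le_trans h _; rewrite le_eqVlt; apply/orP; left; apply/eqP; ring.
- apply: le_trans (ler_wpM2l (sqr_ge0 (enorm w)) (Dn_ge _ _ f r).2).
  rewrite lineE !raddf_sum horner_sum mulr_sumr.
  apply: le_trans (ler_norm_sum _ _ _) _; apply: ler_sum => nu _.
  rewrite /= mul_polyC !derivZ hornerZ normrM.
  have [_ _ /(ler_wpM2l (normr_ge0 (mcoeff nu f))) h] := bnd nu.
  by apply: le_trans h _; rewrite le_eqVlt; apply/orP; left; apply/eqP; ring.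
Qed.

(** * The scalar inequality *)

(** Complete the square: a^2 p + 2 a p1 = (a p + p1)^2 / p - p1^2 / p.  Here p,
    p1, p2 stand for f and its first two derivatives along a vector of squared
    norm W, and a for the first derivative of the exponent. *)
Lemma quadratic_ge (R : realType) (m D N W p a p1 p2 : R) :
    0 < m -> 0 <= N -> m <= p -> 0 <= W ->
    p1 ^+ 2 <= D ^+ 2 * W -> - (D * W) <= p2 ->
  (2 * N * m - D - D ^+ 2 / m) * W <=
    (a ^+ 2 + 2 * N * W) * p + 2 * a * p1 + p2.
Proof.
move=> m0 N0 mp W0 hp1 hp2.
have p0 : 0 < p by exact: lt_le_trans mp.
have sq : a ^+ 2 * p + 2 * a * p1 + p1 ^+ 2 / p = (a * p + p1) ^+ 2 / p.
  by field; rewrite gt_eqF.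
have sq0 : 0 <= (a * p + p1) ^+ 2 / p by rewrite divr_ge0 ?sqr_ge0// ltW.
have p1m : p1 ^+ 2 / p <= D ^+ 2 / m * W.
  rewrite ler_pdivrMr//; apply: le_trans hp1 _.
  rewrite (_ : _ / m * W * p = D ^+ 2 * W * (p / m)); last by ring.
  apply: ler_peMr; first exact: mulr_ge0 (sqr_ge0 D) W0.
  by rewrite ler_pdivlMr ?mul1r.
have Np : 2 * N * W * m <= 2 * N * W * p by rewrite ler_wpM2l ?mulr_ge0.
lra.
Qed.

Lemma calN_gap (R : realType) (m D N : R) :
  0 < m -> calN m D < N -> 0 < 2 * N * m - D - D ^+ 2 / m.
Proof.
move=> m0; rewrite /calN => hN.
have m20 : 0 < 2 * m by rewrite mulr_gt0.
have -> : 2 * N * m - D - D ^+ 2 / m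
    = 2 * m * (N - (D / (2 * m) + D ^+ 2 / (2 * m ^+ 2))).
  by field; rewrite gt_eqF.
by rewrite mulr_gt0// subr_gt0.
Qed.

(** * Strong convexity *)

Theorem theorem3 (R : realType) (n : nat) (f : mpoly n R) (X : set 'rV[R]_n)
    (Xcompact : compact X) (Xconvex : @convex_set R 'rV[R]_n X)
    (fpos : forall x, X x -> 0 < peval f x)
    (r : R) (rE : is_max [set enorm x | x in X] r)
    (fmin : R) (fminE : is_min [set peval f x | x in X] fmin)
    (m : R) (m_gt0 : 0 < m) (m_le : m <= fmin)
    (xi : 'rV[R]_n) (D : R) (D_ge : Dn f r <= D)
    (N : R) (N_gt : calN m D < N) :
  strongly_convex X
    (fun x => expR (N * enorm (x - xi) ^+ 2) * peval f x).
Proof.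
have D1 : 1 <= D by apply: le_trans D_ge; rewrite /Dn le_max lexx.
have D0 : 0 <= D by exact: le_trans D1.
have N0 : 0 <= N.
  apply: le_trans (ltW N_gt).
  by rewrite /calN addr_ge0// divr_ge0 ?sqr_ge0// mulr_ge0 ?sqr_ge0// ltW.
have mu_gt0 := calN_gap _ _ _ _ m_gt0 N_gt.
set mu := 2 * N * m - D - D ^+ 2 / m in mu_gt0.
exists mu => // t y x yX xX.
pose w := x - y.
have Xline s : 0 <= s <= 1 -> X (y + s *: w).
  move=> /andP[s0 s1]; apply/set_mem.
  rewrite -(convE_line _ _ (Itv01 s0 s1) (x : convex_lmodType 'rV[R]_n) y).
  exact: Xconvex.
pose Q := N *: line_sqr (y - xi) w.
pose p := line_poly f y w.
pose q := (mu / 2) *: line_sqr y w.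
(* G along the segment is an exponential-polynomial function of s. *)
pose G (z : 'rV[R]_n) := expR (N * enorm (z - xi) ^+ 2) * peval f z
  - mu / 2 * enorm z ^+ 2.
have GE s : G (y + s *: w) = expR Q.[s] * p.[s] - q.[s].
  by rewrite /G !hornerZ !horner_line_sqr horner_line_poly addrAC.
have G0 : G y = expR Q.[0] * p.[0] - q.[0] by rewrite -GE scale0r addr0.
have G1 : G x = expR Q.[1] * p.[1] - q.[1].
  by rewrite -GE scale1r [y + _]addrC subrK.
have Et : conv t (y : convex_lmodType 'rV[R]_n) x = y + (1 - t%:num) *: w.
  rewrite convE_line /w scalerBl scale1r addrA [y + (x - y)]addrC subrK.
  by rewrite -scalerN opprB.
change (G (conv t y x) <= t%:num * G y + (1 - t%:num) * G x).
rewrite Et GE G0 G1.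
apply: expR_horner_chord => s /andP[s0 s1].
have s01 : 0 <= s <= 1 by rewrite !ltW.
have [p1_le p2_le] :=
  line_poly_deriv_le _ _ f y w s r (rE.2 _ (imageP _ (Xline s s01))).
have DW := sqr_ge0 (enorm w).
have -> : q^`()^`().[s] = mu * enorm w ^+ 2.
  by rewrite !derivZ deriv2_line_sqr hornerZ hornerC; field.
have -> : Q^`()^`().[s] = 2 * N * enorm w ^+ 2.
  by rewrite !derivZ deriv2_line_sqr hornerZ hornerC; ring.
have inner_ge : mu * enorm w ^+ 2 <=
    (Q^`().[s] ^+ 2 + 2 * N * enorm w ^+ 2) * p.[s]
    + 2 * Q^`().[s] * p^`().[s] + p^`()^`().[s].
  apply: quadratic_ge => //.
  - apply: le_trans m_le _; rewrite /p horner_line_poly.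
    exact: fminE.2 _ (imageP _ (Xline s s01)).
  - rewrite -exprMn -real_normK ?num_real//.
    rewrite ler_sqr ?nnegrE ?mulr_ge0 ?enorm_ge0//.
    by apply: le_trans p1_le _; rewrite mulrC ler_wpM2r ?enorm_ge0.
  - rewrite lerNl; apply: le_trans (ler_norm _) _; rewrite normrN.
    by apply: le_trans p2_le _; rewrite mulrC ler_wpM2r.
apply: (le_trans inner_ge); apply: ler_peMl.
  by apply: (le_trans _ inner_ge); rewrite mulr_ge0// ltW.
by rewrite -expR0 ler_expR hornerZ horner_line_sqr mulr_ge0// sqr_ge0.
Qed.
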